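(* Let $D$ be a weighted oriented graph having property $P$ with weight function $w$ on the vertices $x_1,\dots,x_n$. Fix $p\in[n]$ with $w(x_p)\ge 2$, and let $D'_k$ be the weighted oriented graph obtained from $D$ by adding $k$ new vertices $x_{n+1},\dots,x_{n+k}$ and the $k$ oriented edges $(x_{n+i},x_p)$, $i\in[k]$. Then $$\operatorname{reg}(I(D'_k))=\operatorname{reg}(I(D))=\sum_{i=1}^n w(x_i)-|E(D)|+1.$$
   Context: A weighted oriented graph $D=(V(D),E(D),w)$ has directed edges $(x,y)$ and weights $w:V(D)\to\{1,2,\dots\}$; a source vertex (all incident edges oriented away from it) is always assumed to have weight $1$, so the new vertices $x_{n+i}$ have weight $1$. The edge ideal is $I(D)=(x_ix_j^{w(x_j)}:(x_i,x_j)\in E(D))$ in the polynomial ring over a field whose variables are the vertices. A vertex is a leaf if it has exactly one neighbour. $D$ has property $P$ if at most one edge is oriented into each vertex, and for every vertex $x_j$ that is neither a leaf nor a source, either $w(x_j)\ge 2$ or the unique edge $(x_i,x_j)$ into $x_j$ has $x_i$ a leaf. $\operatorname{reg}$ is Castelnuovo–Mumford regularity.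
   Formalization: The second equality, reg(I(D)) = sum of the weights − |E(D)| + 1, is stated only for D without isolated vertices; with an isolated vertex it is false, since that vertex adds its weight to the sum but leaves I(D) unchanged. *)

(* Defs.v *)
From Stdlib Require Import ClassicalEpsilon.
From mathcomp Require Import all_boot all_order all_algebra.
From mathcomp Require Import mpoly.

Set Implicit Arguments.
Unset Strict Implicit.
Unset Printing Implicit Defensive.

Import Order.TTheory GRing.Theory Num.Theory.
Local Open Scope ring_scope.

(* [arc x y] is the edge directed from x to y; the underlying graph is simple.
   The last field is the convention on sources; an isolated vertex is a source
   (vacuously). *)
Record wograph (n : nat) := WOGraph {
  arc : rel 'I_n;
  weight : 'I_n -> nat;
  arc_irrefl : irreflexive arc;
  arc_antisym : forall x y, arc x y -> ~~ arc y x;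
  weight_gt0 : forall x, (0 < weight x)%N;
  weight_source : forall x, (forall y, ~~ arc y x) -> weight x = 1%N
}.

Section WeightedOrientedGraphs.

Variables (n : nat) (D : wograph n).

Definition arcs : {set 'I_n * 'I_n} := [set e | arc D e.1 e.2].

Definition in_neighbours (x : 'I_n) : {set 'I_n} := [set y | arc D y x].

Definition neighbours (x : 'I_n) : {set 'I_n} :=
  [set y | arc D x y || arc D y x].

Definition is_leaf (x : 'I_n) : bool := #|neighbours x| == 1%N.

Definition is_source (x : 'I_n) : bool := in_neighbours x == set0.

Definition no_isolated_vertex : Prop := forall x, neighbours x != set0.

Definition propertyP : Prop :=
  (forall x, (#|in_neighbours x| <= 1)%N) /\
  (forall x, ~~ is_leaf x -> ~~ is_source x ->
     (2 <= weight D x)%N \/ (exists2 y, arc D y x & is_leaf y)).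

Definition edge_ideal (K : fieldType) (f : {mpoly K[n]}) : Prop :=
  exists c : 'I_n * 'I_n -> {mpoly K[n]},
    f = \sum_(e in arcs) c e * ('X_(e.1) * 'X_(e.2) ^+ weight D e.2).

End WeightedOrientedGraphs.

Arguments edge_ideal {n} D K f.

Section AddSources.

Variables (n : nat) (D : wograph n) (p : 'I_n) (k : nat).

(* 'I_(n + k) is 'I_n (the old vertices, [inl]) followed by 'I_k (the new
   ones, [inr]). *)
Definition add_arc (u v : 'I_(n + k)) : bool :=
  match split u, split v with
  | inl x, inl y => arc D x y
  | inr _, inl y => y == p
  | _, inr _ => false
  end.

Definition add_weight (u : 'I_(n + k)) : nat :=
  match split u with inl x => weight D x | inr _ => 1%N end.

Fact add_arc_irrefl : irreflexive add_arc.
Proof.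
by move=> u; rewrite /add_arc; case: (split u) => // x; apply: arc_irrefl.
Qed.

Fact add_arc_antisym u v : add_arc u v -> ~~ add_arc v u.
Proof.
by rewrite /add_arc; case: (split u) (split v) => x [] y //; apply: arc_antisym.
Qed.

Fact add_weight_gt0 u : (0 < add_weight u)%N.
Proof. by rewrite /add_weight; case: (split u) => // x; apply: weight_gt0. Qed.

Fact add_weight_source u : (forall v, ~~ add_arc v u) -> add_weight u = 1%N.
Proof.
rewrite /add_weight /add_arc; case: (split u) => // x h.
apply: weight_source => y; have := h (lshift k y).
by rewrite -[lshift k y]/(unsplit (inl y)) unsplitK.
Qed.

Definition add_sources : wograph (n + k) :=
  WOGraph add_arc_irrefl add_arc_antisym add_weight_gt0 add_weight_source.

End AddSources.

Section Regularity.

Variables (K : fieldType) (n : nat).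
Local Notation S := {mpoly K[n]}.

(* The data of  ... -> F_1 -> F_0 -> S  with F_i = \bigoplus_a S(- shift i a)
   free of rank [rank i]; elements of F_i are row vectors and maps act by
   multiplication on the right. Shifts are natural numbers since a submodule
   of S lives in nonnegative degrees. *)
Record free_complex := FreeComplex {
  rank : nat -> nat;
  shift : forall i, 'I_(rank i) -> nat;
  augm : 'cV[S]_(rank 0);
  diff : forall i, 'M[S]_(rank i.+1, rank i)
}.

Variable F : free_complex.

Definition graded_complex : Prop :=
  (forall b, augm F b ord0 \is (shift b).-homog) /\
  (forall i a b, diff F i a b = 0 \/
     exists2 d, shift a = (shift b + d)%N & diff F i a b \is d.-homog).

Definition resolves (I : S -> Prop) : Prop :=
  [/\ forall f, I f <-> exists u : 'rV_(rank F 0), u *m augm F = f%:M,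
      forall u : 'rV_(rank F 0),
        u *m augm F = 0 <-> exists v, u = v *m diff F 0
    & forall i (u : 'rV_(rank F i.+1)),
        u *m diff F i = 0 <-> exists v, u = v *m diff F i.+1].

(* The image of each differential lies in (x_1, ..., x_n) F_i. *)
Definition minimal_complex : Prop := forall i a b, (diff F i a b)@_0%MM = 0.

Definition minimal_graded_free_resolution (I : S -> Prop) : Prop :=
  [/\ graded_complex, resolves I & minimal_complex].

Definition betti (i j : nat) : nat := #|[set a : 'I_(rank F i) | shift a == j]|.

End Regularity.

Definition is_reg (K : fieldType) (n : nat) (I : {mpoly K[n]} -> Prop)
    (r : int) : Prop :=
  exists F : free_complex K n,
  [/\ minimal_graded_free_resolution F I,
      exists i j : nat, betti F i j != 0%N /\ r = j%:Z - i%:Z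
    & forall i j : nat, betti F i j != 0%N -> j%:Z - i%:Z <= r].

(* Castelnuovo-Mumford regularity max {j - i | betti_(i, j) != 0}; it does not
   depend on the chosen resolution, as minimal graded free resolutions are
   unique up to isomorphism. The value is junk for the zero ideal and for a
   non-homogeneous ideal, which have no [is_reg] value. *)
Definition reg (K : fieldType) (n : nat) (I : {mpoly K[n]} -> Prop) : int :=
  epsilon (inhabits 0) (is_reg I).

(* Main.v *)
From Stdlib Require Import ClassicalEpsilon.
From mathcomp Require Import all_boot all_order all_algebra.
From mathcomp Require Import mpoly zify.
Require Import Defs.

Set Implicit Arguments.
Unset Strict Implicit.
Unset Printing Implicit Defensive.

Import Order.TTheory GRing.Theory Num.Theory.
Local Open Scope ring_scope.

(* Minimal graded free resolutions of an ideal all have the same nonzero Betti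
   numbers, so the regularity can be read off from any one of them.

   Property P says exactly that every generator [x_i x_j^w(x_j)] of [I(D)] has a
   variable (the head if it is a leaf or has weight >= 2, the tail otherwise) to
   a higher power than all other generators. Hence dropping a generator changes
   the lcm, the Taylor resolution is minimal, and [deg lcm(A) - |A| + 1] is
   largest when [A] consists of all the generators, whose lcm is the product of
   the [x_i^w(x_i)].

   In [D'_k] only the generator [m_p] of the old edge into [x_p] can divide the
   lcm of the others. The faces [A] such that [m_p] does not divide
   [lcm(A \ m_p)] form a subcomplex of the Taylor complex (the Lyubeznik
   resolution for an order starting with [m_p]). It is exact since in each
   multidegree it is a cone, and it is minimal. Along faces
   [deg lcm(A) - |A| + 1] is bounded by its value at the set of all generators;
   the old edges form a face where this bound is attained, since each new edge
   adds one new variable to the lcm. *)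

(** * Uniqueness of Betti numbers *)

Section GradedMatrices.

Variables (K : fieldType) (n : nat).
Local Notation S := {mpoly K[n]}.

Definition supported (P : pred 'X_{1..n}) (f : S) := {in msupp f, forall m, P m}.

Lemma supportedP P f : supported P f <-> forall m, ~~ P m -> f@_m = 0.
Proof.
split=> [h m nP | h m].
  by apply/eqP; rewrite mcoeff_eq0; apply: contra nP => /h.
by rewrite mcoeff_msupp; apply: contraR => /h/eqP.
Qed.

Lemma supported_sum P (I : Type) (r : seq I) (Q : pred I) (f : I -> S) :
  (forall i, Q i -> supported P (f i)) -> supported P (\sum_(i <- r | Q i) f i).
Proof.
move=> h; apply/supportedP => m nP; rewrite raddf_sum big1 // => i Qi.
by move/supportedP: (h i Qi); apply.
Qed.

Lemma supportedB P f g : supported P f -> supported P g -> supported P (f - g).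
Proof.
move=> /supportedP hf /supportedP hg; apply/supportedP => m nP.
by rewrite mcoeffB hf // hg // subr0.
Qed.

Lemma supported_split P f :
  exists f1 f2, [/\ f = f1 + f2, supported P f1 & supported (predC P) f2].
Proof.
exists (\sum_(m <- msupp f | P m) f@_m *: 'X_[m]).
exists (\sum_(m <- msupp f | ~~ P m) f@_m *: 'X_[m]).
split; first by rewrite [LHS]mpolyE (bigID P).
  apply: supported_sum => m Pm; apply/supportedP => k nPk.
  rewrite mcoeffZ mcoeffX; case: eqP => [e|_]; last by rewrite mulr0.
  by rewrite -e Pm in nPk.
apply: supported_sum => m Pm; apply/supportedP => k nPk.
rewrite mcoeffZ mcoeffX; case: eqP => [e|_]; last by rewrite mulr0.
by rewrite -e /= Pm in nPk.
Qed.

Lemma supportedM (P Q T : pred 'X_{1..n}) f g :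
  (forall a b, P a -> Q b -> T (a + b)%MM) ->
  supported P f -> supported Q g -> supported T (f * g).
Proof.
move=> h hf hg m /msuppM_le /allpairsP[[a b] /= [fa gb ->]].
by apply: h; [apply: hf | apply: hg].
Qed.

(* Monomials that may occur in the matrix entry of a degree 0 map from a
   generator of degree [s] to one of degree [t]. *)
Definition hdeg (s t : nat) : pred 'X_{1..n} := fun m => s == (t + mdeg m)%N.

Definition graded_mx r c (s : 'I_r -> nat) (t : 'I_c -> nat) (A : 'M[S]_(r, c)) :=
  forall i j, supported (hdeg (s i) (t j)) (A i j).

(** Keep in each entry of [V] only the monomials of the degree prescribed by the shifts. What is
    dropped contributes to [A] only in wrong degrees, so [A - V' *m B] is supported both inside and
    outside the right degree and vanishes. *)
Lemma graded_factor a b c (s : 'I_a -> nat) (t : 'I_b -> nat) (u : 'I_c -> nat)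
    (A : 'M[S]_(a, c)) (B : 'M[S]_(b, c)) (V : 'M[S]_(a, b)) :
    graded_mx s u A -> graded_mx t u B -> A = V *m B ->
  exists2 V', graded_mx s t V' & A = V' *m B.
Proof.
move=> gA gB eA.
have [W hW] : exists W : 'M[S]_(a, b), forall i j,
    supported (hdeg (s i) (t j)) (W i j) /\
    supported (predC (hdeg (s i) (t j))) (V i j - W i j).
  have h i j : exists w, supported (hdeg (s i) (t j)) w /\
    supported (predC (hdeg (s i) (t j))) (V i j - w).
    have [f [g [-> hf hg]]] := supported_split (hdeg (s i) (t j)) (V i j).
    by exists f; rewrite addrAC subrr add0r.
  exists (\matrix_(i, j) epsilon (inhabits 0) (fun w => 
    supported (hdeg (s i) (t j)) w /\
    supported (predC (hdeg (s i) (t j))) (V i j - w))) => i j.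
  rewrite mxE; exact: epsilon_spec (h i j).
exists W => [i j|]; first by have [] := hW i j.
apply/eqP; rewrite -subr_eq0; apply/eqP/matrixP => i j; rewrite [RHS]mxE.
have h1 : supported (hdeg (s i) (u j)) ((A - W *m B) i j).
  rewrite !mxE; apply: supportedB => //; apply: supported_sum => k _.
  have [hk _] := hW i k.
  apply: supportedM hk (gB k j) => m1 m2 /eqP e1 /eqP e2.
  by rewrite /hdeg e1 e2 mdegD -addnA [(mdeg m2 + _)%N]addnC.
have h2 : supported (predC (hdeg (s i) (u j))) ((A - W *m B) i j).
  rewrite eA -mulmxBl !mxE; apply: supported_sum => k _.
  have [_ hk] := hW i k.
  rewrite !mxE; apply: supportedM hk (gB k j) => m1 m2 /= e1 /eqP e2.
  by rewrite /= /hdeg mdegD addnCA -e2 addnC.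
apply/mpolyP => m; rewrite mcoeff0.
move/supportedP/(_ m) : h1; move/supportedP/(_ m) : h2; rewrite /= negbK.
by case: (hdeg _ _ m) => h h'; [apply: h | apply: h'].
Qed.

End GradedMatrices.

(** * Comparison of minimal graded free resolutions *)

Section Uniqueness.

Variables (K : fieldType) (n : nat).
Local Notation S := {mpoly K[n]}.
Local Notation cst := (map_mx (mcoeff (0%MM : 'X_{1..n}))).

Lemma row_factor a b c (A : 'M[S]_(a, c)) (B : 'M[S]_(b, c)) :
  (forall i, exists v, row i A = v *m B) -> exists V, A = V *m B.
Proof.
move=> h; exists (\matrix_i epsilon (inhabits 0) (fun v => row i A = v *m B)).
by apply/row_matrixP => i; rewrite row_mul rowK; exact: epsilon_spec (h i).
Qed.

Section Exactness.

Variables (F : free_complex K n) (I : S -> Prop).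

Hypothesis hF : minimal_graded_free_resolution F I.

Lemma resolution_augm_fact r (A : 'M[S]_(r, rank F 0)) :
  A *m augm F = 0 -> exists V, A = V *m diff F 0.
Proof.
have [_ [_ h _] _] := hF => A0; apply: row_factor => i.
by apply/h; rewrite -row_mul A0 row0.
Qed.

Lemma resolution_diff_fact i r (A : 'M[S]_(r, rank F i.+1)) :
  A *m diff F i = 0 -> exists V, A = V *m diff F i.+1.
Proof.
have [_ [_ _ h] _] := hF => A0; apply: row_factor => j.
by apply/h; rewrite -row_mul A0 row0.
Qed.

Lemma resolution_diff_augm : diff F 0 *m augm F = 0.
Proof.
have [_ [_ h _] _] := hF; apply/row_matrixP => i; rewrite row_mul row0.
by apply/h; exists (delta_mx 0 i); rewrite rowE.
Qed.

Lemma resolution_diff_diff i : diff F i.+1 *m diff F i = 0.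
Proof.
have [_ [_ _ h] _] := hF; apply/row_matrixP => j; rewrite row_mul row0.
by apply/h; exists (delta_mx 0 j); rewrite rowE.
Qed.

Lemma resolution_diff_cst i : cst (diff F i) = 0.
Proof. by have [_ _ h] := hF; apply/matrixP => a b; rewrite !mxE h. Qed.

Lemma resolution_mem a : I (augm F a ord0).
Proof.
have [_ [h _ _] _] := hF; apply/h; exists (delta_mx 0 a).
by rewrite -rowE; apply/matrixP => i j; rewrite !mxE !ord1 eqxx mulr1n.
Qed.

Lemma resolution_augm_gen r (A : 'cV[S]_r) :
  (forall i, I (A i ord0)) -> exists V, A = V *m augm F.
Proof.
have [_ [h _ _] _] := hF => IA; apply: row_factor => i.
have /h [u e] := IA i; exists u; rewrite e.
by apply/matrixP => a b; rewrite !mxE !ord1 eqxx.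
Qed.

Lemma resolution_augm_graded :
  graded_mx (@shift _ _ F 0) (fun=> 0%N) (augm F).
Proof.
have [[h _] _ _] := hF => i j; rewrite ord1 => m hm.
by rewrite /hdeg add0n; have /dhomogP -> := h i.
Qed.

Lemma resolution_diff_graded i :
  graded_mx (@shift _ _ F i.+1) (@shift _ _ F i) (diff F i).
Proof.
have [[_ h] _ _] := hF => a b m.
have [->|[d -> hd]] := h i a b; first by rewrite msupp0.
by move=> hm; rewrite /hdeg; have /dhomogP -> := hd.
Qed.

End Exactness.

Section Comparison.

Variables (F G : free_complex K n) (I : S -> Prop).
Hypotheses (hF : minimal_graded_free_resolution F I)
           (hG : minimal_graded_free_resolution G I).

(* Comparison maps in both directions; their composite is homotopic to the
   identity, hence equal to it modulo the maximal ideal by minimality. *)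
Lemma comparison_maps i :
  exists phi : 'M[S]_(rank F i, rank G i), exists psi : 'M[S]_(rank G i, rank F i),
  exists h : 'M[S]_(rank F i, rank F i.+1),
  [/\ graded_mx (@shift _ _ F i) (@shift _ _ G i) phi,
      (exists V, diff F i *m phi = V *m diff G i),
      (exists V, diff G i *m psi = V *m diff F i),
      diff F i *m (phi *m psi - 1%:M) = diff F i *m h *m diff F i &
      cst phi *m cst psi = 1%:M].
Proof.
elim: i => [|i [phi [psi [h [gphi [V eV] [W eW] eh _]]]]].
  have [phi0 e0] := resolution_augm_gen hG (resolution_mem hF).
  have [phi gphi ephi] :=
    graded_factor (resolution_augm_graded hF) (resolution_augm_graded hG) e0.
  have [psi epsi] := resolution_augm_gen hF (resolution_mem hG).
  have [|h eh] := @resolution_augm_fact _ _ hF _ (phi *m psi - 1%:M).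
    by rewrite mulmxBl mul1mx -mulmxA -epsi -ephi subrr.
  exists phi, psi, h; split=> //.
  - apply: (resolution_augm_fact hG).
    by rewrite -mulmxA -ephi (resolution_diff_augm hF).
  - apply: (resolution_augm_fact hF).
    by rewrite -mulmxA -epsi (resolution_diff_augm hG).
  - by rewrite eh mulmxA.
  - move/(congr1 (cst)): eh; rewrite map_mxB !map_mxM (resolution_diff_cst hF).
    by rewrite map_mx1 mulmx0 => /eqP; rewrite subr_eq0 => /eqP.
have gV : graded_mx (@shift _ _ F i.+1) (@shift _ _ G i) (diff F i *m phi).
  move=> a b; rewrite mxE; apply: supported_sum => k _.
  have gd := @resolution_diff_graded _ _ hF i a k.
  apply: supportedM gd (gphi k b) => m1 m2.
  by rewrite /hdeg => /eqP -> /eqP ->; rewrite mdegD addnAC addnA.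
have [phi' gphi' ephi'] := graded_factor gV (resolution_diff_graded hG (i:=i)) eV.
(* By the homotopy identity one degree below, this defect is killed by [diff F i]; exactness turns
   it into the next homotopy [h']. *)
have [|h' eh'] := @resolution_diff_fact _ _ hF _ _
    (phi' *m W - 1%:M - diff F i *m h).
  rewrite !mulmxBl mul1mx -eh -mulmxA -eW mulmxA -ephi' mulmxBr mulmx1.
  by rewrite mulmxA subrr.
have eh2 : phi' *m W - 1%:M = diff F i *m h + h' *m diff F i.+1.
  by rewrite -eh' [RHS]addrC subrK.
exists phi', W, h'; split=> //.
- apply: (resolution_diff_fact hG).
  by rewrite -mulmxA -ephi' mulmxA (resolution_diff_diff hF) mul0mx.
- apply: (resolution_diff_fact hF).
  by rewrite -mulmxA -eW mulmxA (resolution_diff_diff hG) mul0mx.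
- by rewrite eh2 mulmxDr !mulmxA (resolution_diff_diff hF) mul0mx add0r.
- move/(congr1 (cst)): eh2; rewrite map_mxB [in RHS]map_mxD !map_mxM.
  rewrite !(resolution_diff_cst hF) map_mx1 mulmx0 mul0mx addr0.
  by move=> /eqP; rewrite subr_eq0 => /eqP.
Qed.

(** The constant part of [phi] has a right inverse, so each of its rows has a nonzero entry. A
    graded entry with a nonzero constant term joins generators of equal shift. *)
Lemma betti_neq0_invariant i j : betti F i j != 0%N -> betti G i j != 0%N.
Proof.
rewrite /betti !cards_eq0 => /set0Pn[a]; rewrite inE => /eqP <-.
have [phi [psi [_ [gphi _ _ _ e1]]]] := comparison_maps i.
have [b] : exists b, (phi a b)@_0%MM != 0.
  apply/existsP; apply: contraT; rewrite negb_exists => /forallP h.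
  have /matrixP/(_ a a)/eqP := e1.
  rewrite !mxE eqxx big1 ?(eq_sym 0) ?oner_eq0 // => b _.
  by rewrite !mxE (eqP (negPn (h b))) mul0r.
rewrite -mcoeff_msupp => /gphi; rewrite /hdeg mdeg0 addn0 => /eqP e.
by apply/set0Pn; exists b; rewrite inE e.
Qed.

End Comparison.

Lemma is_reg_unique (I : S -> Prop) r1 r2 : is_reg I r1 -> is_reg I r2 -> r1 = r2.
Proof.
suff le s1 s2 : is_reg I s1 -> is_reg I s2 -> s1 <= s2.
  by move=> h1 h2; apply/eqP; rewrite eq_le !le.
move=> [F [hF [i [j [nz ->]]] _]] [G [hG _ max]].
exact: max _ _ (betti_neq0_invariant hF hG nz).
Qed.

Lemma reg_eq (I : S -> Prop) r : is_reg I r -> reg I = r.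
Proof.
move=> h; apply: (is_reg_unique _ h).
exact: (epsilon_spec (inhabits 0) (is_reg I) (ex_intro _ r h)).
Qed.

End Uniqueness.

(** * The Taylor complex in each multidegree *)

Section SimplexBoundary.

Variables (K : fieldType) (E : finType).
Implicit Types (a q : E) (A B : {set E}) (g : {set E} -> K).

Definition face_sign a B : K :=
  (-1) ^+ #|[set x in B | (enum_rank x < enum_rank a)%N]|.

(* Coordinates of the boundary of [\sum_A g A *: e_A]. *)
Definition simplex_bd g B : K :=
  \sum_(a | a \notin B) face_sign a B * g (a |: B).

(** The join with the vertex [q], a contracting homotopy for [simplex_bd]. *)
Definition simplex_cone q g A : K :=
  if q \in A then face_sign q A * g (A :\ q) else 0.

Lemma face_signU1 a x B : x \notin B ->
  face_sign a (x |: B) = face_sign a B * (-1) ^+ (enum_rank x < enum_rank a)%N.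
Proof.
move=> xB; rewrite /face_sign -exprD addnC; congr (_ ^+ _).
case: ltnP => xa.
  have -> : [set y in x |: B | (enum_rank y < enum_rank a)%N] =
    x |: [set y in B | (enum_rank y < enum_rank a)%N].
    by apply/setP => y; rewrite !inE; case: eqP => [->|//]; rewrite xa.
  by rewrite cardsU1 !inE (negbTE xB).
rewrite add0n; apply: eq_card => y; rewrite !inE.
by case: eqP => [->|//]; rewrite ltnNge xa !andbF.
Qed.

Lemma face_sign0 a : face_sign a set0 = 1.
Proof.
rewrite /face_sign (_ : [set _ in _ | _] = set0) ?cards0 //.
by apply/setP => x; rewrite !inE.
Qed.

Lemma face_sign_sqr a B : face_sign a B * face_sign a B = 1.
Proof. by rewrite -expr2 sqrr_sign. Qed.

(** Exactly one of [a] and [q] precedes the other in the enumeration of [E], so exactly one of the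
    two signs changes. *)
Lemma face_sign_anticomm a q B : q \in B -> a \notin B ->
  face_sign a B * face_sign q (a |: B) = - (face_sign q B * face_sign a (B :\ q)).
Proof.
move=> qB aB; have aq : a != q by apply: contraNneq aB => ->.
rewrite face_signU1 // -{1}(setD1K qB) face_signU1 ?setD11 //.
rewrite mulrACA -signr_addb [face_sign a _ * _]mulrC -[RHS]mulrN1; congr (_ * _).
have : enum_rank a != enum_rank q by rewrite (inj_eq enum_rank_inj).
by rewrite neq_ltn => /orP[h|h]; rewrite h ltnNge (ltnW h).
Qed.

Lemma eq_simplex_bd g1 g2 : g1 =1 g2 -> simplex_bd g1 =1 simplex_bd g2.
Proof. by move=> e B; apply: eq_bigr => a _; rewrite e. Qed.

(** If [q] is outside [B], only the summand [a = q] of the first term survives. If [q] is in [B],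
    that summand of the second term gives [g B], and the others cancel against the first term by
    [face_sign_anticomm]. *)
Lemma simplex_bd_cone q g B :
  simplex_bd (simplex_cone q g) B + simplex_cone q (simplex_bd g) B = g B.
Proof.
rewrite /simplex_bd /simplex_cone; case: ifP => qB; last first.
  rewrite addr0 (bigD1 q) ?qB //= setU11 setU1K ?qB // mulrA.
  rewrite face_signU1 ?qB // ltnn mulr1 face_sign_sqr mul1r.
  rewrite big1 ?addr0 // => a /andP[_ aq].
  by rewrite !inE eq_sym (negbTE aq) qB mulr0.
rewrite [in X in _ + X](bigD1 q) ?setD11 //= setD1K // mulrDr mulrA.
have -> : face_sign q (B :\ q) = face_sign q B.
  by rewrite -{2}(setD1K qB) face_signU1 ?setD11 // ltnn mulr1.
rewrite face_sign_sqr mul1r addrCA mulr_sumr.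
rewrite [X in _ + (_ + X)](eq_bigl (fun a => a \notin B)); last first.
  by move=> a; rewrite !inE; case: eqVneq => [->|_] //=; rewrite ?qB ?andbF ?andbT.
rewrite -big_split /= big1 ?addr0 // => a aB.
rewrite setU1r // mulrA face_sign_anticomm //.
have -> : (a |: B) :\ q = a |: (B :\ q).
  have aq : a != q by apply: contraNneq aB => ->.
  apply/setP => x; rewrite !inE.
  by case: (eqVneq x q) => [->|] //=; rewrite eq_sym (negbTE aq).
by rewrite mulNr -mulrA addNr.
Qed.

(* Evaluated at [q |: B] with [q] outside [B], the homotopy formula
   [bd h + h bd = 1] expresses [bd (bd g) B] through [bd (bd (h g)) (q |: B)]. *)
Lemma simplex_bd_bd g B : simplex_bd (simplex_bd g) B = 0.
Proof.
have [k] := ubnP #|~: B|; elim: k => // k IH in g B *.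
rewrite ltnS => leBk; case: (set_0Vmem (~: B)) => [B0 | [q]].
  rewrite {1}/simplex_bd big_pred0 // => a.
  by rewrite -in_setC B0 inE.
rewrite inE => qB; have := simplex_bd_cone q (simplex_bd g) (q |: B).
have -> : simplex_bd (simplex_cone q (simplex_bd g)) (q |: B) =
    simplex_bd g (q |: B).
  have e A : simplex_cone q (simplex_bd g) A =
      g A - simplex_bd (simplex_cone q g) A.
    by rewrite -(simplex_bd_cone q g A) addrAC subrr add0r.
  rewrite (eq_simplex_bd e) {1}/simplex_bd.
  under eq_bigr do rewrite mulrBr.
  rewrite big_split /= sumrN.
  rewrite -[X in _ - X]/(simplex_bd (simplex_bd (simplex_cone q g)) _).
  rewrite IH ?subr0 // (leq_trans _ leBk) // proper_card //.
  apply/properP; split; first by rewrite setCS subsetU1.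
  by exists q; rewrite inE // negbK setU11.
rewrite /simplex_cone setU11 setU1K // => /eqP.
by rewrite -subr_eq0 addrAC subrr add0r mulf_eq0 signr_eq0 => /eqP.
Qed.

End SimplexBoundary.

(** * Least common multiples of sets of monomials *)

Section MonomialLcm.

Variables (n : nat) (E : finType) (m : E -> 'X_{1..n}).
Implicit Types (a e : E) (A B : {set E}) (b : 'X_{1..n}).

Definition setlcm (A : {set E}) : 'X_{1..n} :=
  [multinom (\max_(e in A) m e i)%N | i < n].

Lemma setlcm_leP A b :
  reflect (forall e, e \in A -> (m e <= b)%MM) (setlcm A <= b)%MM.
Proof.
apply: (iffP mnm_lepP) => [h e eA | h i].
  apply/mnm_lepP => i; apply: leq_trans (h i).
  by rewrite mnmE (leq_bigmax_cond _ eA).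
by rewrite mnmE; apply/bigmax_leqP => e /h/mnm_lepP.
Qed.

Lemma setlcm_ge e A : e \in A -> (m e <= setlcm A)%MM.
Proof. by move: e; apply/setlcm_leP; apply: lepm_refl. Qed.

Lemma setlcmS A B : A \subset B -> (setlcm A <= setlcm B)%MM.
Proof. by move=> sAB; apply/setlcm_leP => e /(subsetP sAB)/setlcm_ge. Qed.

Lemma setlcm_leU1 a A b :
  (setlcm (a |: A) <= b)%MM = (m a <= b)%MM && (setlcm A <= b)%MM.
Proof.
apply/setlcm_leP/andP => [h | [ha /setlcm_leP hA] e]; last first.
  by case/setU1P => [-> | /hA].
by split; [apply/h/setU11 | apply/setlcm_leP => e eA; apply/h/setU1r].
Qed.

Lemma setlcm0 : setlcm set0 = 0%MM.
Proof. by apply/mnmP => i; rewrite mnmE big_set0 mnm0E. Qed.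

Lemma setlcm1 e : setlcm [set e] = m e.
Proof. by apply/mnmP => i; rewrite mnmE big_set1. Qed.

End MonomialLcm.

(** * The Taylor differential and its multigraded strands *)

Section TaylorComplex.

Variables (K : fieldType) (n : nat) (E : finType) (m : E -> 'X_{1..n}).
Local Notation S := {mpoly K[n]}.
Local Notation lcm := (setlcm m).
Implicit Types (a q : E) (A B : {set E}) (c : {set E} -> S).

(** At most one [a] meets the condition; the sum supplies the value 0 when [A] is not [B] with one
    element added. *)
Definition taylor_coeff A B : S :=
  \sum_(a | (a \notin B) && (A == a |: B)) face_sign K a B *: 'X_[lcm A - lcm B].

Definition taylor_bd c B : S := \sum_A c A * taylor_coeff A B.

(* Coefficient of [x^(b - lcm A) e_A], of multidegree [b], in [\sum_A c A e_A]. *)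
Definition multidegree_part (b : 'X_{1..n}) c A : K :=
  if (lcm A <= b)%MM then (c A)@_(b - lcm A) else 0.

Lemma taylor_bdE c B : taylor_bd c B =
  \sum_(a | a \notin B)
     face_sign K a B *: (c (a |: B) * 'X_[lcm (a |: B) - lcm B]).
Proof.
rewrite /taylor_bd /taylor_coeff; under eq_bigr do rewrite mulr_sumr.
rewrite (exchange_big_dep (fun a => a \notin B)) /=; last by move=> A a _ /andP[].
apply: eq_bigr => a aB; rewrite (big_pred1 (a |: B)).
  by rewrite scalerAr.
by move=> A; rewrite aB.
Qed.

Lemma mcoeffMX_nle (f : S) d k : ~~ (d <= k)%MM -> (f * 'X_[d])@_k = 0.
Proof.
move=> h; apply/eqP; rewrite mcoeff_eq0 (perm_mem (msuppMX f d)).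
by apply: contra h => /mapP[k' _ ->]; apply: lem_addr.
Qed.

(** The monomial factor of the Taylor differential only accounts for the passage from [b - lcm A] to
    [b - lcm B]. In a fixed multidegree the simplicial boundary over the field is left. *)
Lemma multidegree_part_bd b c B :
  multidegree_part b (taylor_bd c) B = simplex_bd (multidegree_part b c) B.
Proof.
rewrite /simplex_bd {1}/multidegree_part taylor_bdE; case: ifP => leB; last first.
  rewrite big1 // => a _; rewrite /multidegree_part setlcm_leU1 leB andbF mulr0 //.
rewrite raddf_sum /=; apply: eq_bigr => a aB; rewrite mcoeffZ; congr (_ * _).
have leBA : (lcm B <= lcm (a |: B))%MM by apply/setlcmS/subsetU1.
rewrite /multidegree_part; case: ifP => leA.
  rewrite -[RHS](mcoeffMX _ (lcm (a |: B) - lcm B)); congr (_@__).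
  apply/mnmP => i; rewrite !(mnmDE, mnmBE) addnC addnBA ?subnK //.
    exact: (mnm_lepP leA).
  exact: (mnm_lepP leBA).
apply: mcoeffMX_nle; apply: contraFN leA => /mnm_lepP h; apply/mnm_lepP => i.
have := h i; rewrite !mnmBE leq_subLR subnKC //; exact: (mnm_lepP leB).
Qed.

Lemma multidegree_part_ext c1 c2 A :
  (forall b, multidegree_part b c1 A = multidegree_part b c2 A) -> c1 A = c2 A.
Proof.
move=> h; apply/mpolyP => k; have := h (k + lcm A)%MM.
by rewrite /multidegree_part lem_addl addmK.
Qed.

Lemma taylor_bd_bd c B : taylor_bd (taylor_bd c) B = 0.
Proof.
apply: (@multidegree_part_ext _ (fun=> 0)) => b.
rewrite multidegree_part_bd (eq_simplex_bd (multidegree_part_bd b c)).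
by rewrite simplex_bd_bd /multidegree_part mcoeff0 if_same.
Qed.

Lemma multidegree_part_bounded c :
  exists k, forall b A, multidegree_part b c A != 0 -> (mdeg b < k)%N.
Proof.
exists (\max_A (msize (c A) + mdeg (lcm A)))%N => b A.
rewrite /multidegree_part; case: ifP => [le|_]; last by rewrite eqxx.
rewrite -mcoeff_msupp => /msize_mdeg_lt lt.
apply: leq_trans (leq_bigmax A).
by rewrite -{1}(submK le) mdegD -addSn leq_add2r.
Qed.

(** Coefficients are polynomials, hence finite sums: the common degree bound [k] is what allows
    infinitely many strands to be assembled into one chain. *)
Lemma multidegree_parts_glue (g : 'X_{1..n} -> {set E} -> K) k :
    (forall b A, g b A != 0 -> (lcm A <= b)%MM && (mdeg b < k)%N) ->
  exists c, forall b, multidegree_part b c =1 g b.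
Proof.
move=> h; exists (fun A => \sum_(u : 'X_{1..n < k}) g (u + lcm A)%MM A *: 'X_[u]).
move=> b A; rewrite /multidegree_part; case: ifP => le; last first.
  by apply/esym/eqP; apply: contraFT le => /h/andP[].
have [lt|ge] := ltnP (mdeg (b - lcm A)) k.
  by rewrite (mcoeff_mpoly (fun u => g (u + lcm A)%MM A)) // submK.
rewrite raddf_sum big1 /= => [|u _].
  apply/esym/eqP; apply: contraLR ge => /h/andP[_].
  by rewrite -ltnNge; apply/leq_ltn_trans/mdegB.
rewrite mcoeffZ mcoeffX; case: eqP => [e|_]; last by rewrite mulr0.
by move: (bmdeg u); rewrite e ltnNge ge.
Qed.

End TaylorComplex.

(** * A Lyubeznik resolution *)

Section RowsAndChains.

Variables (R : nzRingType) (T : finType) (X : {set T}).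

(** Extension by zero outside [X], obtained from an empty sum. It lets the differentials be computed
    on all subsets of [E]. *)
Definition row_chain (u : 'rV[R]_#|X|) (x : T) : R :=
  \sum_(i | enum_val i == x) u ord0 i.

Definition chain_row (c : T -> R) : 'rV[R]_#|X| := \row_i c (enum_val i).

Lemma row_chain_out u x : x \notin X -> row_chain u x = 0.
Proof.
move=> xX; apply: big1 => i /eqP e.
by rewrite -e enum_valP in xX.
Qed.

Lemma row_chainK : cancel row_chain chain_row.
Proof.
move=> u; apply/rowP => i; rewrite mxE /row_chain (big_pred1 i) // => j.
by rewrite (inj_eq enum_val_inj).
Qed.

Lemma chain_rowK c : (forall x, x \notin X -> c x = 0) ->
  row_chain (chain_row c) =1 c.
Proof.
move=> h x; have [xX|xX] := boolP (x \in X); last by rewrite row_chain_out ?h.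
rewrite /row_chain (big_pred1 (enum_rank_in xX x)) ?mxE ?enum_rankK_in // => i.
by rewrite /= -(inj_eq enum_val_inj) enum_rankK_in.
Qed.

Lemma sum_row_chain u (f : T -> R) :
  \sum_x row_chain u x * f x = \sum_i u ord0 i * f (enum_val i).
Proof.
rewrite [RHS](partition_big enum_val predT) //=; apply: eq_bigr => x _.
by rewrite mulr_suml; apply: eq_bigr => i /eqP ->.
Qed.

End RowsAndChains.

(** * The Lyubeznik complex with one distinguished generator *)

Section LyubeznikResolution.

Variables (K : fieldType) (n : nat) (E : finType) (m : E -> 'X_{1..n}).
Variables (G : {set E}) (p0 : E).
Local Notation S := {mpoly K[n]}.
Local Notation lcm := (setlcm m).
Implicit Types (a q : E) (A B : {set E}) (c : {set E} -> S).

Definition monomial_ideal (f : S) : Prop :=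
  exists c : E -> S, f = \sum_(e in G) c e * 'X_[m e].

(* The Lyubeznik complex for an order in which [p0] comes first, when no other
   generator divides the lcm of the remaining ones. *)
Definition is_face A := (A \subset G) && ~~ (m p0 <= lcm (A :\ p0))%MM.

(** The ideal is resolved, not the quotient by it, so degree 0 consists of single generators. *)
Definition faces i : {set {set E}} := [set A | is_face A && (#|A| == i.+1)].

Definition lyubeznik_complex : free_complex K n :=
  @FreeComplex K n (fun i => #|faces i|)
    (fun i s => mdeg (lcm (enum_val s)))
    (\col_s 'X_[lcm (enum_val s)])
    (fun i => \matrix_(s, t) taylor_coeff K m (enum_val s) (enum_val t)).

Hypothesis p0G : p0 \in G.
Hypothesis p0_neq0 : m p0 != 0%MM.
Hypothesis p0_ndvd : forall q, q \in G -> q != p0 -> ~~ (m p0 <= m q)%MM.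
Hypothesis private_variable : forall q, q \in G -> q != p0 ->
  exists x, forall r, r \in G -> r != q -> (m r x < m q x)%N.

Lemma is_faceS A B : B \subset A -> is_face A -> is_face B.
Proof.
move=> sBA /andP[sAG nA]; rewrite /is_face (subset_trans sBA sAG).
by apply: contra nA => /lepm_trans; apply; apply/setlcmS/setSD.
Qed.

(** For [q = p0] the lcm to be tested is that of the empty set, namely 1, whence the role of
    [p0_neq0]. *)
Lemma is_face1 q : q \in G -> is_face [set q].
Proof.
move=> qG; rewrite /is_face sub1set qG /=; have [->|qp] := eqVneq q p0.
  rewrite setDv setlcm0; apply: contra p0_neq0 => /mnm_lepP h.
  by apply/eqP/mnmP => i; apply/eqP; have := h i; rewrite mnm0E leqn0.
have -> : [set q] :\ p0 = [set q].
  by apply/setDidPl; rewrite disjoint_sym disjoints1 inE eq_sym.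
by rewrite setlcm1 p0_ndvd.
Qed.

Lemma mem_faces0 A : (A \in faces 0) = [exists q in G, A == [set q]].
Proof.
rewrite inE; apply/andP/exists_inP => [[fA /cards1P[q eA]]|[q qG /eqP ->]].
  exists q; last exact/eqP.
  by case/andP: fA; rewrite eA sub1set.
by rewrite is_face1 // cards1.
Qed.

(** The exponent of the private variable in [m a] is positive, being larger than the one in [m p0];
    this covers the case where [B] is empty. *)
Lemma setlcm_private_lt a B : a \in G -> a != p0 -> B \subset G -> a \notin B ->
  exists x, (lcm B x < lcm (a |: B) x)%N.
Proof.
move=> aG ap sBG aB; have [x hx] := private_variable aG ap; exists x.
have lt0 : (lcm B x < m a x)%N.
  rewrite mnmE; have : (0 < m a x)%N.
    by apply: leq_ltn_trans (hx p0 p0G _); rewrite // eq_sym.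
  case ma: (m a x) => [//|k] _; rewrite ltnS; apply/bigmax_leqP => e eB.
  rewrite -ltnS -ma hx //; last by apply: contraNneq aB => <-.
  exact: (subsetP sBG).
apply: (leq_trans lt0); exact/(mnm_lepP (setlcm_ge m (setU11 a B))).
Qed.

(** The source of minimality: adding [p0] enlarges the lcm by the definition of a face, adding any
    other generator by its private variable. *)
Lemma setlcm_face_lt a B : is_face (a |: B) -> a \notin B ->
  exists x, (lcm B x < lcm (a |: B) x)%N.
Proof.
move=> fA aB; have aBG : a |: B \subset G by case/andP: fA.
have aG : a \in G by apply: (subsetP aBG); apply: setU11.
have [ea|ap] := eqVneq a p0; last first.
  by apply: setlcm_private_lt => //; apply: subset_trans aBG; apply: subsetU1.
have : ~~ (m a <= lcm B)%MM by case/andP: fA => _; rewrite -ea setU1K.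
move/mnm_lepP => h; apply/existsP; apply: contraT => /existsPn h'; case: h => i.
have := h' i; rewrite -leqNgt => /(leq_trans _); apply.
exact/(mnm_lepP (setlcm_ge m (setU11 a B))).
Qed.

Lemma mdeg_setlcm_lt a B : (exists x, (lcm B x < lcm (a |: B) x)%N) ->
  (mdeg (lcm B) < mdeg (lcm (a |: B)))%N.
Proof.
move=> [x lt].
rewrite !mdegE (bigD1 x) // [X in (_ < X)%N](bigD1 x) //= -addSn leq_add //.
by apply: leq_sum => i _; apply/(mnm_lepP (setlcmS m (subsetU1 a B))).
Qed.

Lemma taylor_coeff_eq0 A B : ~ (exists2 a, a \notin B & A = a |: B) ->
  taylor_coeff K m A B = 0.
Proof.
by move=> h; apply: big1 => a /andP[aB /eqP e]; case: h; exists a.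
Qed.

(** Faces are closed under subsets, so the Taylor differential restricts to chains of faces. *)
Lemma faces_down i A B : A \in faces i.+1 -> B \notin faces i ->
  taylor_coeff K m A B = 0.
Proof.
rewrite !inE => /andP[fA /eqP cA] nB; apply: taylor_coeff_eq0 => -[a aB eA].
case/negP: nB; rewrite (is_faceS _ fA) ?eA ?subsetU1 //=.
by move: cA; rewrite eA cardsU1 aB add1n => -[->].
Qed.

(* In multidegree [b] the complex is a cone with this apex. *)
Definition apex (b : 'X_{1..n}) : option E :=
  if (m p0 <= b)%MM then Some p0 else [pick q in G | (m q <= b)%MM].

(** Joining the apex [p0] does not affect the set tested in [is_face]. If the apex is another
    generator, [m p0] does not divide the monomial of multidegree [b], hence no lcm dividing that
    monomial. *)
Lemma is_face_apex b q A : apex b = Some q -> q \in A ->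
    is_face (A :\ q) -> (lcm (A :\ q) <= b)%MM ->
  is_face A && (lcm A <= b)%MM.
Proof.
move=> eq_b qA /andP[sG nA] leb.
have [qG mqb] : q \in G /\ (m q <= b)%MM.
  move: eq_b; rewrite /apex; case: ifP => [le [<-]//|_].
  by case: pickP => // x /andP[? ?] [<-].
have leA : (lcm A <= b)%MM by rewrite -(setD1K qA) setlcm_leU1 mqb.
rewrite leA andbT /is_face -{1}(setD1K qA) subUset sub1set qG sG /=.
move: eq_b; rewrite /apex; case: ifP => [le [eq]|nle _].
  by move: nA; rewrite eq setDDl setUid.
apply/negP => le; case/negP: nle; apply: lepm_trans le _.
by apply: lepm_trans leA; apply/setlcmS/subD1set.
Qed.

Lemma apex_ge b A : A \subset G -> A != set0 -> (lcm A <= b)%MM -> apex b != None.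
Proof.
move=> sAG /set0Pn[e eA] le; rewrite /apex; case: ifP => // _.
case: pickP => // /(_ e); rewrite (subsetP sAG) //=.
by rewrite (lepm_trans _ le) // setlcm_ge.
Qed.

(** In each multidegree a cycle is the boundary of its cone from the apex; the cones are then glued
    to one chain. *)
Lemma taylor_bd_exact i c : (forall A, A \notin faces i -> c A = 0) ->
    (forall B, taylor_bd m c B = 0) ->
  exists2 v, (forall A, A \notin faces i.+1 -> v A = 0) &
    forall B, c B = taylor_bd m v B.
Proof.
move=> supp_c bd0.
pose g b A := if apex b is Some q then simplex_cone q (multidegree_part m b c) A
  else 0.
have supp_part b A : multidegree_part m b c A != 0 ->
    (A \in faces i) && (lcm A <= b)%MM.
  rewrite /multidegree_part; case: ifP; rewrite ?eqxx // andbT => _.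
  by apply: contraR => /supp_c ->; rewrite mcoeff0.
have supp_g b A : g b A != 0 -> (A \in faces i.+1) && (lcm A <= b)%MM.
  rewrite /g; case eb: (apex b) => [q|]; rewrite ?eqxx // /simplex_cone.
  case: ifP => [qA|]; rewrite ?eqxx // mulf_eq0 signr_eq0 /=.
  case/supp_part/andP; rewrite !inE => /andP[fA cA] leb.
  have /andP[-> ->] := is_face_apex eb qA fA leb.
  by rewrite (cardsD1 q) qA (eqP cA) eqxx.
have [k bk] := multidegree_part_bounded m c.
have [|v hv] := @multidegree_parts_glue K n E m g k.
  move=> b A gA; have /andP[_ ->] := supp_g _ _ gA.
  move: gA; rewrite /g; case: (apex b) => [q|]; rewrite ?eqxx // /simplex_cone.
  by case: ifP => _; rewrite ?eqxx // mulf_eq0 signr_eq0 => /bk.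
exists v => [A nA | B].
  apply: (@multidegree_part_ext K n E m _ (fun=> 0)) => b.
  rewrite hv /multidegree_part mcoeff0 if_same; apply/eqP.
  by apply: contraNT nA => /supp_g/andP[].
apply: (@multidegree_part_ext K n E m) => b.
rewrite multidegree_part_bd (eq_simplex_bd (hv b)) /g.
(* Without an apex no generator divides the monomial of multidegree [b]; as faces are nonempty, this
   strand of [c] is zero. *)
case eb: (apex b) => [q|]; last first.
  rewrite /simplex_bd big1 => [|a _]; last by rewrite mulr0.
  apply/eqP; apply: contraT => /supp_part/andP[].
  rewrite inE => /andP[/andP[sBG _] /eqP cB] /(apex_ge sBG).
  by rewrite -cards_eq0 cB eb => /(_ isT).
(* In the homotopy formula the cone over the boundary of [c] vanishes, [c] being a cycle. *)
rewrite -[LHS](simplex_bd_cone q) [X in _ + X]/simplex_cone.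
rewrite -multidegree_part_bd /multidegree_part bd0 mcoeff0 if_same mulr0.
by rewrite if_same addr0.
Qed.

Lemma lyubeznik_mul_diff i (u : 'rV_#|faces i.+1|) b :
  (u *m diff lyubeznik_complex i) ord0 b =
    taylor_bd m (row_chain u) (enum_val b).
Proof.
rewrite mxE [RHS]sum_row_chain; apply: eq_bigr => a _.
by rewrite mxE.
Qed.

Lemma lyubeznik_diff_eq0 i (u : 'rV_#|faces i.+1|) :
  u *m diff lyubeznik_complex i = 0 <->
  forall B, taylor_bd m (row_chain u) B = 0.
Proof.
split=> [u0 B | h]; last first.
  by apply/rowP => b; rewrite [LHS]lyubeznik_mul_diff h mxE.
have [fB|nB] := boolP (B \in faces i).
  by rewrite -(enum_rankK_in fB fB) -lyubeznik_mul_diff u0 mxE.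
apply: big1 => A _; have [fA|nA] := boolP (A \in faces i.+1).
  by rewrite (faces_down fA nB) mulr0.
by rewrite row_chain_out ?mul0r.
Qed.

Lemma taylor_coeff_set1 q : taylor_coeff K m [set q] set0 = 'X_[m q].
Proof.
rewrite /taylor_coeff (big_pred1 q) => [|a].
  by rewrite setlcm1 setlcm0 subm0 face_sign0 scale1r.
by rewrite inE setU0 (inj_eq set1_inj) /= eq_sym.
Qed.

(** The augmentation is the component of the Taylor differential at the empty set, so exactness in
    degree 0 is treated like the other degrees. *)
Lemma lyubeznik_mul_augm (u : 'rV_#|faces 0|) :
  (u *m augm lyubeznik_complex) ord0 ord0 = taylor_bd m (row_chain u) set0.
Proof.
rewrite mxE [RHS]sum_row_chain; apply: eq_bigr => a _.
rewrite mxE; congr (_ * _); have := enum_valP a.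
rewrite mem_faces0 => /exists_inP[q _ /eqP ->].
by rewrite taylor_coeff_set1 setlcm1.
Qed.

Lemma lyubeznik_augm_eq0 (u : 'rV_#|faces 0|) :
  u *m augm lyubeznik_complex = 0 <->
  forall B, taylor_bd m (row_chain u) B = 0.
Proof.
split=> [u0 B | h]; last first.
  by apply/rowP => b; rewrite ord1 [LHS]lyubeznik_mul_augm h mxE.
have [->|nB] := eqVneq B set0; first by rewrite -lyubeznik_mul_augm u0 mxE.
apply: big1 => A _; have [fA|nA] := boolP (A \in faces 0); last first.
  by rewrite row_chain_out ?mul0r.
rewrite taylor_coeff_eq0 ?mulr0 // => -[a aB eA].
move: fA nB; rewrite inE eA cardsU1 aB add1n -cards_eq0 => /andP[_ /eqP [->]].
by rewrite eqxx.
Qed.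

Lemma lyubeznik_exact i (u : 'rV_#|faces i|) :
  (forall B, taylor_bd m (row_chain u) B = 0) <->
  exists v, u = v *m diff lyubeznik_complex i.
Proof.
split=> [bd0 | [v ->] B].
  have [v sv ev] := taylor_bd_exact (@row_chain_out _ _ _ u) bd0.
  exists (chain_row _ v); rewrite -[LHS]row_chainK; apply/rowP => b.
  rewrite mxE ev [RHS]lyubeznik_mul_diff /taylor_bd.
  by apply: eq_bigr => A _; rewrite chain_rowK.
rewrite -[RHS](taylor_bd_bd m (row_chain v) B).
apply: eq_bigr => A _; congr (_ * _).
rewrite -[RHS](@chain_rowK _ _ (faces i) (taylor_bd m (row_chain v))); last first.
  move=> A' nA'; apply: big1 => A2 _.
  have [fA|nA] := boolP (A2 \in faces i.+1).
    by rewrite (faces_down fA nA') mulr0.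
  by rewrite row_chain_out ?mul0r.
congr (row_chain _ _); apply/rowP => b.
by rewrite [LHS]lyubeznik_mul_diff mxE.
Qed.

Lemma taylor_bd_set0 c : taylor_bd m c set0 = \sum_q c [set q] * 'X_[m q].
Proof.
rewrite taylor_bdE; apply: eq_big => [q|q _]; first by rewrite inE.
by rewrite setU0 setlcm1 setlcm0 subm0 face_sign0 scale1r.
Qed.

Lemma set1_notin_faces0 q : q \notin G -> [set q] \notin faces 0.
Proof.
apply: contra; rewrite mem_faces0 => /exists_inP[r rG /eqP/set1_inj ->].
exact: rG.
Qed.

Lemma lyubeznik_augm_image f :
  monomial_ideal f <-> exists u, u *m augm lyubeznik_complex = f%:M.
Proof.
split=> [[c ->]|[u eu]]; last first.
  exists (fun q => row_chain u [set q]).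
  have /matrixP/(_ ord0 ord0) := eu; rewrite lyubeznik_mul_augm.
  rewrite [f%:M _ _]mxE eqxx mulr1n taylor_bd_set0 => <-.
  rewrite [RHS]big_mkcond /=; apply: eq_bigr => q _; case: ifPn => // qG.
  by rewrite row_chain_out ?mul0r // set1_notin_faces0.
pose d A := \sum_(q in G | A == [set q]) c q.
exists (chain_row _ d); apply/matrixP => i j; rewrite !ord1.
rewrite [LHS]lyubeznik_mul_augm [RHS]mxE eqxx mulr1n taylor_bd_set0.
rewrite [RHS]big_mkcond /=; apply: eq_bigr => q _.
rewrite chain_rowK => [|A nA]; last first.
  apply: big1 => r /andP[rG /eqP eA].
  by move: nA; rewrite eA mem_faces0 => /exists_inP[]; exists r.
case: ifPn => qG; last first.
  rewrite /d big_pred0 ?mul0r // => r.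
  rewrite (inj_eq set1_inj) andbC; case: eqP => [<-|//].
  by rewrite (negbTE qG).
congr (_ * _); rewrite /d (big_pred1 q) // => r.
rewrite (inj_eq set1_inj) /= eq_sym; case: eqP => [->|_].
  by rewrite qG.
by rewrite andbF.
Qed.

Lemma lyubeznik_graded : graded_complex lyubeznik_complex.
Proof.
split=> [s | i s t]; first by rewrite mxE dhomogX.
rewrite mxE; set A := enum_val s; set B := enum_val t.
case: (classic (exists2 a, a \notin B & A = a |: B));
  last by move=> /taylor_coeff_eq0 ->; left.
move=> [a aB eA].
right; exists (mdeg (lcm A - lcm B)).
  have le : (lcm B <= lcm A)%MM by rewrite eA; apply/setlcmS/subsetU1.
  by rewrite /= -/A -/B addnC -mdegD submK.
by apply: rpred_sum => q _; apply: rpredZ; rewrite dhomogX.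
Qed.

Lemma lyubeznik_minimal : minimal_complex lyubeznik_complex.
Proof.
move=> i s t; rewrite mxE raddf_sum /=; apply: big1 => a /andP[aB /eqP eA].
rewrite mcoeffZ mcoeffX; case: eqP => [e0|_]; last by rewrite mulr0.
have := enum_valP s; rewrite inE eA => /andP[fA _].
have [x lt] := setlcm_face_lt fA aB.
move/mnmP/(_ x): e0; rewrite eA mnmBE mnm0E => /eqP.
by rewrite subn_eq0 leqNgt lt.
Qed.

Lemma lyubeznik_resolution :
  minimal_graded_free_resolution lyubeznik_complex monomial_ideal.
Proof.
split; [exact: lyubeznik_graded | | exact: lyubeznik_minimal].
split=> [f|u|i u]; first exact: lyubeznik_augm_image.
  exact: iff_trans (lyubeznik_augm_eq0 u) (lyubeznik_exact u).
exact: iff_trans (lyubeznik_diff_eq0 u) (lyubeznik_exact u).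
Qed.

Lemma lyubeznik_betti i j :
  betti lyubeznik_complex i j != 0%N <->
  exists2 A, A \in faces i & mdeg (lcm A) = j.
Proof.
rewrite /betti cards_eq0; split=> [/set0Pn[s]|[A fA <-]].
  by rewrite inE => /eqP <-; exists (enum_val s); rewrite ?enum_valP.
apply/set0Pn; exists (enum_rank_in fA A).
by rewrite inE /= enum_rankK_in.
Qed.

(** With [p0] already in [B], every generator still to be added has a private variable and raises
    the degree by at least one. *)
Lemma mdeg_setlcm_grow B : B \subset G -> p0 \in B ->
  (mdeg (lcm B) + #|G :\: B| <= mdeg (lcm G))%N.
Proof.
have [k] := ubnP #|G :\: B|; elim: k => // k IH in B *.
rewrite ltnS => lek sBG pB; have [GB0|[a]] := set_0Vmem (G :\: B).
  have -> : B = G by apply/eqP; rewrite eqEsubset sBG -setD_eq0 GB0 eqxx.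
  by rewrite setDv cards0 addn0.
rewrite inE => /andP[aB aG]; have ap : a != p0 by apply: contraNneq aB => ->.
have cGB : #|G :\: B| = #|G :\: (a |: B)|.+1.
  by rewrite (cardsD1 a) inE aB aG add1n setDDl setUC.
have := mdeg_setlcm_lt (setlcm_private_lt aG ap sBG aB).
rewrite cGB addnS -addSn => lt; apply: leq_trans (IH (a |: B) _ _ _).
- by rewrite leq_add2r.
- by rewrite -cGB.
- by rewrite subUset sub1set aG.
- exact: setU1r.
Qed.

(* Adding to a face first [p0], and then the other generators one by one, the
   degree of the lcm increases at each step. *)
Lemma mdeg_face_bound A : is_face A ->
  (mdeg (lcm A) + #|G :\: A| <= mdeg (lcm G))%N.
Proof.
move=> fA; have sAG : A \subset G by case/andP: fA.
have [pA|pA] := boolP (p0 \in A); first exact: mdeg_setlcm_grow.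
have fpA : is_face (p0 |: A).
  have /andP[_ nA] := fA; rewrite /is_face subUset sub1set p0G sAG setU1K //=.
  apply: contra nA => /lepm_trans; apply; apply: setlcmS.
  by rewrite subsetD1 subxx.
apply: leq_trans (mdeg_setlcm_grow (B := p0 |: A) _ (setU11 _ _)); last first.
  by case/andP: fpA.
have := mdeg_setlcm_lt (setlcm_face_lt fpA pA).
rewrite (cardsD1 p0 (G :\: A)) inE pA p0G add1n setDDl setUC.
by rewrite addnS -addSn leq_add2r.
Qed.

(** A face [A] contributes the degree of its lcm minus [#|A| - 1], and [mdeg_face_bound] bounds this
    by the value at [G]. The face [A0] attains the bound, since [G] itself may fail to be a face. *)
Lemma monomial_ideal_is_reg A0 : is_face A0 -> A0 != set0 ->
    (mdeg (lcm G) <= mdeg (lcm A0) + #|G :\: A0|)%N ->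
  is_reg monomial_ideal ((mdeg (lcm G))%:Z - #|G|%:Z + 1).
Proof.
move=> f0 nz0 le0; exists lyubeznik_complex.
have cG A : is_face A -> #|G| = (#|A| + #|G :\: A|)%N.
  by move=> /andP[sAG _]; rewrite -[LHS](cardsID A) (setIidPr sAG).
have pos0 : (0 < #|A0|)%N by rewrite card_gt0.
split; first exact: lyubeznik_resolution.
  exists #|A0|.-1, (mdeg (lcm A0)); split.
    apply/lyubeznik_betti; exists A0 => //.
    by rewrite inE f0 prednK /=.
  by have := cG _ f0; have := mdeg_face_bound f0; lia.
move=> i j /lyubeznik_betti[A]; rewrite inE => /andP[fA /eqP cA] <-.
have := mdeg_face_bound fA; rewrite (cG _ fA) cA.
by lia.
Qed.

End LyubeznikResolution.

(** * Edge ideals *)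

Lemma is_reg_ext (K : fieldType) n (I J : {mpoly K[n]} -> Prop) r :
  (forall f, I f <-> J f) -> is_reg I r -> is_reg J r.
Proof.
move=> IJ [F [[gF [h0 h1 h2] mF] ex max]]; exists F; split=> //; split=> //.
by split=> // f; rewrite -h0; split=> /IJ.
Qed.

Section EdgeMonomials.

Variables (n : nat) (D : wograph n).
Implicit Types (e r q : 'I_n * 'I_n) (x y : 'I_n).

Definition edge_mnm e : 'X_{1..n} := (U_(e.1) + U_(e.2) *+ weight D e.2)%MM.

Lemma edge_mnmE e x :
  edge_mnm e x = ((e.1 == x) + (e.2 == x) * weight D e.2)%N.
Proof. by rewrite mnmDE mulmnE !mnm1E. Qed.

Lemma edge_mnm_le e x : e \in arcs D -> (edge_mnm e x <= weight D x)%N.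
Proof.
case: e => u v; rewrite inE edge_mnmE /= => uv.
case: (eqVneq u x) => [eux|_]; last by case: eqP => [->|//]; rewrite mul1n.
case: (eqVneq v x) => [evx|_]; last exact: weight_gt0.
by move: uv; rewrite eux evx arc_irrefl.
Qed.

Lemma edge_mnm_head u v : (weight D v <= edge_mnm (u, v) v)%N.
Proof. by rewrite edge_mnmE eqxx mul1n leq_addl. Qed.

Lemma edge_idealE (K : fieldType) (f : {mpoly K[n]}) :
  edge_ideal D K f <-> monomial_ideal edge_mnm (arcs D) f.
Proof.
have E e : 'X_(e.1) * 'X_(e.2) ^+ weight D e.2 = 'X_[edge_mnm e] :> {mpoly K[n]}.
  by rewrite mpolyXD mpolyXn.
by split=> -[c ->]; exists c; apply: eq_bigr => e _; rewrite E.
Qed.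

(** A vertex with an incoming edge reaches its weight as a head; any other vertex is a source of
    weight 1 and reaches it as a tail. *)
Lemma setlcm_arcs_nonisolated x : neighbours D x != set0 ->
  setlcm edge_mnm (arcs D) x = weight D x.
Proof.
move=> /set0Pn[y]; rewrite inE => xy; apply/eqP; rewrite eqn_leq; apply/andP; split.
  by rewrite mnmE; apply/bigmax_leqP => e /edge_mnm_le.
suff [e eD le] : exists2 e, e \in arcs D & (weight D x <= edge_mnm e x)%N.
  exact/(leq_trans le)/(mnm_lepP (setlcm_ge edge_mnm eD)).
have [/existsP[z zx]|/existsPn nz] := boolP [exists z, arc D z x].
  by exists (z, x); rewrite ?inE ?edge_mnm_head.
exists (x, y); first by move: xy; rewrite inE (negbTE (nz y)) orbF.
by rewrite weight_source // edge_mnmE eqxx.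
Qed.

Hypothesis hP : propertyP D.

Lemma propertyP_tail y z x : arc D y x -> arc D z x -> y = z.
Proof.
move=> yx zx; have [/(_ x)/card_le1P h _] := hP.
have /h : y \in in_neighbours D x by rewrite inE.
by move=> /(_ z); rewrite inE zx => /esym/eqP.
Qed.

Lemma leaf_neighbour x y z : is_leaf D x ->
  y \in neighbours D x -> z \in neighbours D x -> y = z.
Proof. by move=> /cards1P[w ->]; rewrite !inE => /eqP-> /eqP->. Qed.

Lemma leaf_arc x q r : is_leaf D x -> q \in arcs D -> r \in arcs D ->
  (q.1 == x) || (q.2 == x) -> (r.1 == x) || (r.2 == x) -> q = r.
Proof.
case: q r => [a b] [c d] lx; rewrite !inE /= => ab cd.
have nb u v : arc D u v -> (u \in neighbours D v) && (v \in neighbours D u).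
  by move=> uv; rewrite !inE uv orbT.
have /andP[n1 n2] := nb _ _ ab; have /andP[n3 n4] := nb _ _ cd.
case/orP=> /eqP e1 /orP[] /eqP e2; subst.
- by rewrite (leaf_neighbour lx n2 n4).
(* The mixed orientations would give two antiparallel edges. *)
- by move: (arc_antisym cd); rewrite (leaf_neighbour lx n3 n2) ab.
- by move: (arc_antisym cd); rewrite (leaf_neighbour lx n4 n1) ab.
- by rewrite (leaf_neighbour lx n1 n3).
Qed.

(** A leaf lies on one edge only, so a leaf at either end works. Otherwise the head has weight at
    least 2, while no other edge points to it, so all others have exponent at most 1 there. *)
Lemma private_vertex q : q \in arcs D ->
  exists x, forall r, r \in arcs D -> r != q -> (edge_mnm r x < edge_mnm q x)%N.
Proof.
case: q => u v uv; have uvD : arc D u v by rewrite inE in uv.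
have leafP x : is_leaf D x -> (u == x) || (v == x) ->
    forall r, r \in arcs D -> r != (u, v) -> (edge_mnm r x < edge_mnm (u, v) x)%N.
  move=> lx xuv r rD; apply: contraNT; rewrite -leqNgt => le.
  apply/eqP; apply: (leaf_arc lx) => //; apply: contraTT le.
  rewrite negb_or -ltnNge !edge_mnmE /= => /andP[/negbTE-> /negbTE->].
  rewrite mul0n addn0; case/orP: xuv => ->; first by [].
  by rewrite mul1n ltn_addl // weight_gt0.
have [lv|nlv] := boolP (is_leaf D v).
  by exists v; apply: leafP => //; rewrite eqxx orbT.
have nsv : ~~ is_source D v.
  by apply/set0Pn; exists u; rewrite inE.
have [_ /(_ v nlv nsv)[w2|[y yv ly]]] := hP; last first.
  by exists y; apply: leafP; rewrite // (propertyP_tail uvD yv) eqxx.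
exists v => -[a b]; rewrite inE /= => ab ne.
apply: leq_trans (edge_mnm_head u v); apply: leq_trans w2.
rewrite edge_mnmE /= ltnS; case: (eqVneq b v) => [eb|_].
  by move: ab ne; rewrite eb => ab; rewrite (propertyP_tail ab uvD) eqxx.
by rewrite mul0n addn0; case: (a == v).
Qed.

Lemma edge_mnm_head_le1 u v r : arc D u v -> r \in arcs D -> r != (u, v) ->
  (edge_mnm r v <= 1)%N.
Proof.
case: r => a b uv; rewrite inE edge_mnmE /= => ab ne.
case: (eqVneq b v) => [eb|_]; last by rewrite mul0n addn0; case: (a == v).
by move: ab ne; rewrite eb => ab; rewrite (propertyP_tail ab uv) eqxx.
Qed.

Lemma edge_mnm_ndvd q r : q \in arcs D -> r \in arcs D -> r != q ->
  ~~ (edge_mnm q <= edge_mnm r)%MM.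
Proof.
move=> qD rD rq; have [x hx] := private_vertex qD.
by apply/mnm_lepP => /(_ x); rewrite leqNgt hx.
Qed.

(** The distinguished generator is an edge into a vertex of weight at least 2. Here the set of all
    edges is a face, so the Lyubeznik complex is the whole Taylor complex. *)
Lemma edge_ideal_is_reg (K : fieldType) u v : arc D u v -> (2 <= weight D v)%N ->
  is_reg (edge_ideal D K)
    ((mdeg (setlcm edge_mnm (arcs D)))%:Z - #|arcs D|%:Z + 1).
Proof.
move=> uv w2; have uvD : (u, v) \in arcs D by rewrite inE.
have w2' := leq_trans w2 (edge_mnm_head u v).
apply: (@is_reg_ext _ _ (monomial_ideal edge_mnm (arcs D))).
  by move=> f; split=> /edge_idealE.
apply: (@monomial_ideal_is_reg _ _ _ edge_mnm (arcs D) (u, v) uvD _ _ _ (arcs D)).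
- by apply: contraTneq w2' => ->; rewrite mnm0E.
- by move=> q qD; apply: edge_mnm_ndvd.
- by move=> q qD _; apply: private_vertex.
- rewrite /is_face subxx /=; apply/mnm_lepP => /(_ v).
  rewrite leqNgt (leq_trans _ w2') // ltnS mnmE.
  by apply/bigmax_leqP => r /setD1P[ne rD]; apply: (edge_mnm_head_le1 uv).
- by apply/set0Pn; exists (u, v).
- by rewrite leq_addr.
Qed.

End EdgeMonomials.

(** * The graph with added sources *)

Section AddSourcesRegularity.

Variables (n : nat) (D : wograph n) (p : 'I_n) (k : nat).
Local Notation D' := (add_sources D p k).
Implicit Types (e : 'I_n * 'I_n) (x y : 'I_n) (i j : 'I_k).

Lemma split_lshift x : split (lshift k x) = inl x.
Proof. exact: (unsplitK (inl x)). Qed.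

Lemma split_rshift j : split (rshift n j) = inr j.
Proof. exact: (unsplitK (inr j)). Qed.

Definition old_arc e : 'I_(n + k) * 'I_(n + k) := (lshift k e.1, lshift k e.2).

Definition new_arc j : 'I_(n + k) * 'I_(n + k) := (rshift n j, lshift k p).

Lemma old_arc_inj : injective old_arc.
Proof. by move=> [a b] [c d] [/val_inj-> /val_inj->]. Qed.

Lemma mem_old_arc e : (old_arc e \in arcs D') = (e \in arcs D).
Proof. by rewrite !inE /= /add_arc !split_lshift. Qed.

Variant add_sources_arc_spec : 'I_(n + k) * 'I_(n + k) -> Prop :=
  | OldArc e of e \in arcs D : add_sources_arc_spec (old_arc e)
  | NewArc j : add_sources_arc_spec (new_arc j).

Lemma add_sources_arcP r : r \in arcs D' -> add_sources_arc_spec r.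
Proof.
case: r => a b; rewrite inE /= /add_arc.
case: (split_ordP a) => x ->; case: (split_ordP b) => y -> //.
  by move=> xy; apply: (@OldArc (x, y)); rewrite inE.
by move=> /eqP ->; apply: NewArc.
Qed.

Lemma mem_new_arc j : new_arc j \in arcs D'.
Proof. by rewrite inE /= /add_arc split_lshift split_rshift eqxx. Qed.

Lemma weight_lshift x : weight D' (lshift k x) = weight D x.
Proof. by rewrite /= /add_weight split_lshift. Qed.

Lemma edge_mnm_old_lshift e x :
  edge_mnm D' (old_arc e) (lshift k x) = edge_mnm D e x.
Proof. by rewrite !edge_mnmE weight_lshift !(inj_eq (@lshift_inj _ _)). Qed.

Lemma edge_mnm_old_rshift e j : edge_mnm D' (old_arc e) (rshift n j) = 0%N.
Proof. by rewrite edge_mnmE !eq_lrshift. Qed.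

Lemma edge_mnm_new_lshift j x :
  edge_mnm D' (new_arc j) (lshift k x) = ((p == x) * weight D p)%N.
Proof.
by rewrite edge_mnmE weight_lshift eq_rlshift (inj_eq (@lshift_inj _ _)).
Qed.

Lemma edge_mnm_new_rshift i j :
  edge_mnm D' (new_arc i) (rshift n j) = (i == j).
Proof. by rewrite edge_mnmE eq_lrshift (inj_eq (@rshift_inj _ _)) addn0. Qed.

Local Notation old_arcs := (old_arc @: arcs D).

Lemma setlcm_old_lshift x :
  setlcm (edge_mnm D') old_arcs (lshift k x) = setlcm (edge_mnm D) (arcs D) x.
Proof.
rewrite !mnmE big_imset /=; last by move=> ? ? _ _; apply: old_arc_inj.
by apply: eq_bigr => e _; rewrite edge_mnm_old_lshift.
Qed.

Lemma setlcm_old_rshift j : setlcm (edge_mnm D') old_arcs (rshift n j) = 0%N.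
Proof.
rewrite mnmE big_imset /=; last by move=> ? ? _ _; apply: old_arc_inj.
by rewrite big1 // => e _; rewrite edge_mnm_old_rshift.
Qed.

Lemma mdeg_setlcm_old :
  mdeg (setlcm (edge_mnm D') old_arcs) = mdeg (setlcm (edge_mnm D) (arcs D)).
Proof.
rewrite !mdegE big_split_ord /= [X in (_ + X)%N]big1 => [|j _].
  by rewrite addn0; apply: eq_bigr => x _; rewrite setlcm_old_lshift.
exact: setlcm_old_rshift.
Qed.

Lemma card_new_arcs : (k <= #|arcs D' :\: old_arcs|)%N.
Proof.
have inj : injective new_arc by move=> i j /(congr1 fst)/rshift_inj.
rewrite -{1}(card_ord k) -cardsT -(card_imset _ inj); apply/subset_leq_card.
apply/subsetP => _ /imsetP[j _ ->]; rewrite inE mem_new_arc andbT.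
apply/negP => /imsetP[e _ /(congr1 fst)/eqP].
by rewrite eq_rlshift.
Qed.

Lemma edge_mnm_new_le u j x :
  (edge_mnm D' (new_arc j) (lshift k x) <= edge_mnm D (u, p) x)%N.
Proof. by rewrite edge_mnm_new_lshift edge_mnmE leq_addl. Qed.

(** The power of [p] in a new generator is already reached by the old edge [(u, p)], so old
    variables gain nothing, and each of the [k] new variables has exponent at most 1. *)
Lemma mdeg_setlcm_add_sources u : arc D u p ->
  (mdeg (setlcm (edge_mnm D') (arcs D')) <=
     mdeg (setlcm (edge_mnm D') old_arcs) + #|arcs D' :\: old_arcs|)%N.
Proof.
move=> up; apply: (@leq_trans (mdeg (setlcm (edge_mnm D') old_arcs) + k)).
  rewrite mdeg_setlcm_old !mdegE big_split_ord /=; apply: leq_add.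
    apply: leq_sum => x _; rewrite mnmE; apply/bigmax_leqP => r /add_sources_arcP[].
      move=> e eD; rewrite edge_mnm_old_lshift.
      exact/(mnm_lepP (setlcm_ge (edge_mnm D) eD)).
    move=> j; apply: leq_trans (edge_mnm_new_le u j x) _.
    by apply/(mnm_lepP (setlcm_ge (edge_mnm D) _)); rewrite inE.
  rewrite -[X in (_ <= X)%N]card_ord -sum1_card; apply: leq_sum => j _.
  rewrite mnmE; apply/bigmax_leqP => r /add_sources_arcP[e _|i].
    by rewrite edge_mnm_old_rshift.
  by rewrite edge_mnm_new_rshift; case: eqP.
by rewrite leq_add2l card_new_arcs.
Qed.

Lemma add_sources_is_reg (K : fieldType) u : propertyP D -> arc D u p ->
    (2 <= weight D p)%N ->
  is_reg (edge_ideal D' K)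
    ((mdeg (setlcm (edge_mnm D) (arcs D)))%:Z - #|arcs D|%:Z + 1).
Proof.
move=> hP up w2; have upD : (u, p) \in arcs D by rewrite inE.
have w2' := leq_trans w2 (edge_mnm_head D u p).
pose p0 := old_arc (u, p).
have p0D : p0 \in arcs D' by rewrite mem_old_arc.
have neq0 : edge_mnm D' p0 != 0%MM.
  apply/eqP => /mnmP/(_ (lshift k p)); rewrite edge_mnm_old_lshift mnm0E => e0.
  by rewrite e0 in w2'.
have ndvd q : q \in arcs D' -> q != p0 ->
    ~~ (edge_mnm D' p0 <= edge_mnm D' q)%MM.
  move=> /add_sources_arcP[e eD|j] ne.
    rewrite (inj_eq old_arc_inj) in ne.
    apply: contra (edge_mnm_ndvd hP upD eD ne) => /mnm_lepP h.
    by apply/mnm_lepP => x; have := h (lshift k x); rewrite !edge_mnm_old_lshift.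
  (* The variable of [u] divides the generator of [p0] but no new generator, as [u] differs from
     [p]. *)
  apply/mnm_lepP => /(_ (lshift k u)); rewrite edge_mnm_old_lshift.
  rewrite edge_mnm_new_lshift edge_mnmE eqxx.
  by case: eqP up => [<-|//]; rewrite arc_irrefl.
have priv q : q \in arcs D' -> q != p0 -> exists z, forall r, r \in arcs D' ->
    r != q -> (edge_mnm D' r z < edge_mnm D' q z)%N.
  move=> /add_sources_arcP[e eD|j] ne.
    rewrite (inj_eq old_arc_inj) in ne.
    have [x hx] := private_vertex hP eD; exists (lshift k x) => r.
    rewrite edge_mnm_old_lshift => /add_sources_arcP[e' e'D|j] ne'.
      by rewrite edge_mnm_old_lshift hx // -(inj_eq old_arc_inj).
    (* On old variables a new generator is dominated by that of [(u, p)], an edge different from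
       [e]. *)
    by apply: leq_ltn_trans (edge_mnm_new_le u j x) _; rewrite hx // eq_sym.
  exists (rshift n j) => r; rewrite edge_mnm_new_rshift eqxx.
  case/add_sources_arcP => [e _ _|i ne']; first by rewrite edge_mnm_old_rshift.
  by rewrite edge_mnm_new_rshift; case: (eqVneq i j) ne' => [->|//]; rewrite eqxx.
have face : is_face (edge_mnm D') (arcs D') p0 old_arcs.
  apply/andP; split.
    by apply/subsetP => _ /imsetP[e eD ->]; rewrite mem_old_arc.
  apply/mnm_lepP => /(_ (lshift k p)); rewrite edge_mnm_old_lshift.
  (* At [p] the generator of [p0] has exponent at least 2, the other old ones at most 1. *)
  rewrite leqNgt (leq_trans _ w2') // ltnS mnmE.
  apply/bigmax_leqP => r /setD1P[ne /imsetP[e eD er]].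
  rewrite er edge_mnm_old_lshift (edge_mnm_head_le1 hP up) //.
  by rewrite -(inj_eq old_arc_inj) -er.
have nz : old_arcs != set0 by apply/set0Pn; exists p0; apply: imset_f.
have le := mdeg_setlcm_add_sources up.
(* The degree of the lcm and the number of edges both grow by the number of new edges. *)
have -> : (mdeg (setlcm (edge_mnm D) (arcs D)))%:Z - #|arcs D|%:Z + 1 =
    (mdeg (setlcm (edge_mnm D') (arcs D')))%:Z - #|arcs D'|%:Z + 1 :> int.
  have -> : #|arcs D'| = (#|arcs D| + #|arcs D' :\: old_arcs|)%N.
    have /andP[sub _] := face.
    by rewrite -[LHS](cardsID old_arcs) (setIidPr sub) (card_imset _ old_arc_inj).
  rewrite -mdeg_setlcm_old.
  have /eqP -> : mdeg (setlcm (edge_mnm D') (arcs D')) ==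
      (mdeg (setlcm (edge_mnm D') old_arcs) + #|arcs D' :\: old_arcs|)%N.
    by rewrite eqn_leq le (mdeg_face_bound p0D priv face).
  by rewrite !PoszD opprD addrACA subrr addr0.
apply: is_reg_ext (monomial_ideal_is_reg K p0D neq0 ndvd priv face nz le).
by move=> f; split=> /edge_idealE.
Qed.

End AddSourcesRegularity.

(** An isolated vertex adds 1 to the sum of the weights but does not occur in the ideal; hence the
    assumption [no_isolated_vertex] for the closed formula. *)
Theorem theorem3p10 (K : fieldType) (n : nat) (D : wograph n) (p : 'I_n)
    (k : nat) (hP : propertyP D) (hp : (2 <= weight D p)%N) :
  reg (edge_ideal (add_sources D p k) K) = reg (edge_ideal D K) /\
  (no_isolated_vertex D ->
     reg (edge_ideal D K) =
       (\sum_(i < n) (weight D i)%:Z) - (#|arcs D|)%:Z + 1).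
Proof.
(* A vertex of weight at least 2 is not a source. *)
have [u up] : exists u, arc D u p.
  apply/existsP; apply: contraTT hp => /existsPn h.
  by rewrite weight_source.
have regD := reg_eq (edge_ideal_is_reg hP K up hp).
split; first by rewrite regD (reg_eq (add_sources_is_reg k K hP up hp)).
move=> ni; rewrite regD mdegE (big_morph Posz PoszD (erefl _)).
by congr (_ - _ + _); apply: eq_bigr => x _; rewrite setlcm_arcs_nonisolated.
Qed.
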